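(* For any normalized (not necessarily quasi-greedy) basis $\{\mathbf e_j\}_{j=1}^\infty$ of a (real or complex) Banach space $\mathbb X$ we have $$\frac{k_N}{4}\,\le\, D_N\,\le\, 2k_N,\qquad \forall\,N=1,2,\ldots$$
   Context: $\mathbb X$ is a real or complex Banach space with norm $\|\cdot\|$, and $\{\mathbf e_j\}_{j=1}^\infty$ is a countable (Schauder) basis, normalized: $\|\mathbf e_j\|=1$ for all $j$. Each $x\in\mathbb X$ has a unique expansion $x=\sum_{j=1}^\infty a_j\mathbf e_j$. For finite $A\subset\mathbb N$, $S_A(x)=\sum_{j\in A}a_j\mathbf e_j$, and $k_N=\sup_{|A|\le N}\|S_A\|$ (operator norm). $\Sigma_N$ is the set of all $y\in\mathbb X$ with at most $N$ nonzero coefficients in the basis expansion, and $\sigma_N(x)=\inf_{y\in\Sigma_N}\|x-y\|$. The expansional best approximation error is $\tilde\sigma_N(x)=\inf_{|A|=N}\|x-\sum_{k\in A}a_k\mathbf e_k\|$, the infimum over $A\subset\mathbb N$ with $|A|=N$. $D_N=\sup_{x\in\mathbb X}\dfrac{\tilde\sigma_N(x)}{\sigma_N(x)}$, the supremum being over all $x$ with $\sigma_N(x)\ne0$ (if $\sigma_N(x)=0$ then $x\in\Sigma_N$ and $\tilde\sigma_N(x)=0$). *)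

(* Defs.v *)
From mathcomp Require Import all_boot all_order all_algebra.
From mathcomp Require Import finmap.
From mathcomp Require Import all_classical all_reals all_analysis.
From mathcomp Require Import complex.

Set Implicit Arguments.
Unset Strict Implicit.
Unset Printing Implicit Defensive.

Import Order.TTheory GRing.Theory Num.Theory.
Import numFieldNormedType.Exports.

Local Open Scope classical_set_scope.
Local Open Scope ring_scope.

(* Bases are indexed from 0: [e j] is the vector usually written e_{j+1}. *)
Section Basis.
Context {K : numFieldType} {V : normedModType K}.
Implicit Types (e : nat -> V) (x y : V) (A : {fset nat}) (N : nat).

Definition expansion e x (a : nat -> K) : Prop :=
  series (fun j => a j *: e j) @ \oo --> x.

Definition schauder_basis e : Prop :=
  forall x, exists! a : nat -> K, expansion e x a.

Definition normalized e : Prop := forall j, `|e j| = 1.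

(* The default value is never used when [e] is a Schauder basis. *)
Definition coef e x : nat -> K := xget (fun=> 0) [set a | expansion e x a].

Definition S_ e A x : V := \sum_(j <- A) coef e x j *: e j.

Definition Sigma e N : set V :=
  [set y | ([set j | coef e y j != 0%R] #<= `I_N)%card].

End Basis.

(* In a [normedModType R[i]] the norm `|x| is a (real, nonnegative) element of
   R[i].  To take suprema and infima in R for both scalar fields, the
   definitions below take the R-valued norm [nrm] as an argument. *)
Section Constants.
Context {R : realType} {K : numFieldType} {V : normedModType K}.
Variable nrm : V -> R.
Implicit Types (e : nat -> V) (x y : V) (A : {fset nat}) (N : nat).

Definition opnorm (T : V -> V) : \bar R :=
  ereal_sup [set (nrm (T x))%:E | x in [set x | nrm x <= 1]].

Definition k_ e N : \bar R :=
  ereal_sup [set opnorm (S_ e A) | A in [set A | (#|` A| <= N)%N]].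

Definition sigma e N x : R := inf [set nrm (x - y) | y in Sigma e N].

Definition sigma_exp e N x : R :=
  inf [set nrm (x - S_ e A x) | A in [set A | #|` A| = N]].

Definition D_ e N : \bar R :=
  ereal_sup [set (sigma_exp e N x / sigma e N x)%:E
            | x in [set x | sigma e N x != 0]].

End Constants.

Definition real_norm {R : realType} {V : normedModType R} (x : V) : R := `|x|.

Definition complex_norm {R : realType} {V : normedModType R[i]} (x : V) : R :=
  complex.Re `|x|.

(* Main.v *)
Require Import Defs.
From mathcomp Require Import all_boot all_order all_algebra.
From mathcomp Require Import finmap.
From mathcomp Require Import all_classical all_reals all_analysis.
From mathcomp Require Import complex.
From mathcomp Require Import ring lra.

(** For the upper bound, let y have at most N nonzero coefficients and let A be
    a set of N indices that contains their support.  Then S_A y = y, so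
      x - S_A x = (x - y) - S_A (x - y)
    has norm at most (1 + k_N) |x - y|, and k_N >= 1 because S_{0} e_0 = e_0
    ([D_le_2k]).

    For the lower bound, let |A| = N and replace by one large scalar t all the
    coefficients of x with index in A; call the result z.  It differs from x by
    an N-term vector, so sigma_N(z) <= |x|.  An N-term residual z - S_B z with
    B <> A keeps a coefficient t, hence is large, while z - S_A z = x - S_A x.
    So the expansional error of z is at least |x - S_A x|, and we get
    |x - S_A x| <= D_N |x| ([residual_le_D]).  A set A with fewer than N
    elements is first completed to N elements by indices so large that S_A x
    changes by at most 1.  Since D_N >= 1, for |x| <= 1 this gives
      |S_A x| <= 1 + D_N + 1 <= 4 D_N  ([quarter_k_le_D]).

    The coefficient functionals must be bounded, uniformly since the basis is
    normalized: this makes residuals with a large coefficient large, and it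
    makes sigma_N(z) nonzero for z outside Sigma_N, without which D_N could be
    the supremum of too few ratios, or of none.  It is Banach's theorem on the
    partial sum operators ([partial_bounded]), where completeness of the space
    is used.  By Baire's theorem, vectors whose partial sums are bounded by a
    multiple of |x| come arbitrarily close to any x; correcting the error
    again and again writes x as the sum of a series of such vectors, whose
    expansions can be added up ([partial_limit]).

    The real and the complex case share one proof, in which the scalar field
    K is only known through a real-valued version of its norms ([realNorms]). *)

Set Implicit Arguments.
Unset Strict Implicit.
Unset Printing Implicit Defensive.

Import Order.TTheory GRing.Theory Num.Theory.
Import numFieldNormedType.Exports.

Local Open Scope classical_set_scope.
Local Open Scope ring_scope.

(** * Real-valued norms over a real or complex scalar field *)

(** Convergence is stated with a real-valued size [p] so that one definition
    serves for vectors and for scalars, and every [eps] is real even when the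
    norm takes its values in [R[i]]. *)
Definition tends {R : realType} {E : zmodType} (p : E -> R) (u : nat -> E)
    (l : E) :=
  forall eps : R, 0 < eps ->
    exists M, forall n, (M <= n)%N -> p (l - u n) <= eps.

Definition cauchy_seq {R : realType} {E : zmodType} (p : E -> R)
    (u : nat -> E) :=
  forall eps : R, 0 < eps ->
    exists M, forall m n, (M <= m)%N -> (M <= n)%N -> p (u m - u n) <= eps.

(** What the proof needs to know of the scalars: the nonnegative elements of K,
    among them all norms, form a copy of those of R, and K is complete.
    Completeness is needed to sum coefficients index by index. *)
Record realNorms (R : realType) (K : numFieldType) := RealNorms {
  emb : {rmorphism R -> K};
  rpart : K -> R;
  emb_le : forall r s : R, (emb r <= emb s) = (r <= s);
  embK : forall r, rpart (emb r) = r;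
  rpartK : forall a : K, 0 <= a -> emb (rpart a) = a;
  scalars_complete : forall u : nat -> K,
    cauchy_seq (fun a : K => rpart `|a|) u ->
    exists l, tends (fun a : K => rpart `|a|) u l }.

Definition nrm {R : realType} {K : numFieldType} (h : realNorms R K)
    {E : normedZmodType K} (x : E) : R := rpart h `|x|.

Arguments emb_le {R K} r0.
Arguments embK {R K} r0.
Arguments rpartK {R K} r0 [a].

Section Norms.
Context {R : realType} {K : numFieldType} (h : realNorms R K).
Local Notation emb := (emb h).
Local Notation nrm := (nrm h).

Lemma emb_nrm (E : normedZmodType K) (x : E) : emb (nrm x) = `|x|.
Proof. exact: rpartK. Qed.

Lemma emb_lt r s : (emb r < emb s) = (r < s).
Proof. by rewrite !lt_def (emb_le h) (inj_eq (can_inj (embK h))). Qed.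

Lemma emb_ge0 r : (0 <= emb r) = (0 <= r).
Proof. by rewrite -(rmorph0 emb) (emb_le h). Qed.

Lemma nrm_emb r : 0 <= r -> nrm (emb r) = r.
Proof. by move=> r0; rewrite /nrm ger0_norm ?emb_ge0 ?embK. Qed.

Lemma nrm_ge0 (E : normedZmodType K) (x : E) : 0 <= nrm x.
Proof. by rewrite -emb_ge0 emb_nrm. Qed.

Lemma nrm0 (E : normedZmodType K) : nrm (0 : E) = 0.
Proof. by rewrite /nrm normr0 -(rmorph0 emb) embK. Qed.

Lemma nrm_gt0 (E : normedZmodType K) (x : E) : (0 < nrm x) = (x != 0).
Proof. by rewrite -emb_lt emb_nrm rmorph0 normr_gt0. Qed.

Lemma nrmN (E : normedZmodType K) (x : E) : nrm (- x) = nrm x.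
Proof. by rewrite /nrm normrN. Qed.

Lemma nrmBC (E : normedZmodType K) (x y : E) : nrm (x - y) = nrm (y - x).
Proof. by rewrite -nrmN opprB. Qed.

Lemma nrmD (E : normedZmodType K) (x y : E) : nrm (x + y) <= nrm x + nrm y.
Proof. by rewrite -(emb_le h) rmorphD !emb_nrm ler_normD. Qed.

Lemma nrmB (E : normedZmodType K) (x y : E) : nrm (x - y) <= nrm x + nrm y.
Proof. by rewrite -(nrmN y) nrmD. Qed.

Lemma nrm_triangle (E : normedZmodType K) (z x y : E) :
  nrm (x - y) <= nrm (x - z) + nrm (z - y).
Proof. by rewrite -(emb_le h) rmorphD !emb_nrm ler_distD. Qed.

Lemma nrm_sum (E : normedZmodType K) (I : Type) (s : seq I) (F : I -> E) :
  nrm (\sum_(i <- s) F i) <= \sum_(i <- s) nrm (F i).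
Proof.
rewrite -(emb_le h) rmorph_sum/= emb_nrm.
under [leRHS]eq_bigr do rewrite emb_nrm.
exact: ler_norm_sum.
Qed.

Lemma nrmZ (V : normedModType K) (a : K) (x : V) :
  nrm (a *: x) = nrm a * nrm x.
Proof.
apply: (can_inj (embK h)).
by rewrite rmorphM/= !emb_nrm normrZ.
Qed.

Lemma nrmZ_emb (V : normedModType K) (r : R) (x : V) : 0 <= r ->
  nrm (emb r *: x) = r * nrm x.
Proof. by move=> r0; rewrite nrmZ nrm_emb. Qed.

Lemma tends_cvg (V : normedModType K) (u : nat -> V) (l : V) :
  tends nrm u l <-> u @ \oo --> l.
Proof.
split=> [ul|ul eps e0].
  apply/cvgrPdist_le => eps e0.
  have e0' : 0 < rpart h eps by rewrite -emb_lt rmorph0 rpartK// ltW.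
  have [M uM] := ul _ e0'; exists M => // n /= /uM.
  by rewrite -(emb_le h) emb_nrm rpartK// ltW.
have e0' : 0 < emb eps by rewrite -(rmorph0 emb) emb_lt.
move/cvgrPdist_le: ul => /(_ _ e0') [M _ uM]; exists M => n /uM /=.
by rewrite -emb_nrm (emb_le h).
Qed.

Lemma cauchy_tends (V : completeNormedModType K) (u : nat -> V) :
  cauchy_seq nrm u -> exists l, tends nrm u l.
Proof.
move=> cu; suff /cvg_ex[l /tends_cvg ul] : cvg (u @ \oo) by exists l.
apply/cauchy_cvgP/cauchy_exP => eps e0.
have e0' : 0 < rpart h eps by rewrite -emb_lt rmorph0 rpartK// ltW.
have [|M uM] := cu (rpart h eps / 2); first by rewrite divr_gt0.
exists (u M), M => // n /= Mn; rewrite -ball_normE/=.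
rewrite -emb_nrm -(rpartK h (ltW e0)) emb_lt.
apply: le_lt_trans (uM _ _ _ _) _ => //.
by rewrite ltr_pdivrMr// ltr_pMr// ltr1n.
Qed.

Lemma tends_dist_le (V : normedModType K) (u : nat -> V) (l y : V) (c : R) :
  tends nrm u l -> (exists M, forall n, (M <= n)%N -> nrm (u n - y) <= c) ->
  nrm (l - y) <= c.
Proof.
move=> ul [M uc]; apply/ler_addgt0Pl => eps /ul[M' ulM'].
rewrite (le_trans (nrm_triangle (u (maxn M M')) _ _))// lerD//.
  by rewrite ulM'// leq_maxr.
by rewrite uc// leq_maxl.
Qed.

End Norms.

(** * The real and the complex scalars *)

Lemma real_complete (R : realType) (u : nat -> R) :
  cauchy_seq Num.norm u -> exists l, tends Num.norm u l.
Proof.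
move=> cu; suff /cvg_ex[l /cvgrPdist_le ul] : cvg (u @ \oo).
  exists l => eps e0; have [M _ uM] := ul _ e0.
  by exists M => n /uM.
apply/cauchy_cvgP/cauchy_exP => eps e0.
have [|M uM] := cu (eps / 2); first by rewrite divr_gt0.
exists (u M), M => // n /= Mn; rewrite -ball_normE/=.
apply: le_lt_trans (uM _ _ _ _) _ => //.
by rewrite ltr_pdivrMr// ltr_pMr// ltr1n.
Qed.

Definition realNorms_real (R : realType) : realNorms R R :=
  @RealNorms R R idfun idfun (fun=> fun=> erefl) (fun=> erefl)
    (fun=> fun=> erefl) (@real_complete R).

Lemma Re_normc_le (R : realType) (z : R[i]) :
  complex.Re `|z| <= `|complex.Re z| + `|complex.Im z|.
Proof.
rewrite normc_def/= -[leRHS]ger0_norm ?addr_ge0// -sqrtr_sqr ler_wsqrtr//.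
rewrite sqrrD !real_normK ?num_real// [leRHS]addrAC lerDl.
by rewrite mulrn_wge0 ?mulr_ge0.
Qed.

Lemma normr_Im_le (R : realType) (z : R[i]) :
  `|complex.Im z| <= complex.Re `|z|.
Proof.
by rewrite normc_def/= -sqrtr_sqr ler_wsqrtr// lerDr sqr_ge0.
Qed.

Lemma normr_Re_le (R : realType) (z : R[i]) :
  `|complex.Re z| <= complex.Re `|z|.
Proof.
by rewrite normc_def/= -sqrtr_sqr ler_wsqrtr// lerDl sqr_ge0.
Qed.

Lemma complex_complete (R : realType) (u : nat -> R[i]) :
  cauchy_seq (fun a => complex.Re `|a|) u ->
  exists l, tends (fun a => complex.Re `|a|) u l.
Proof.
move=> cu.
have [|a ua] := @real_complete R (fun n => complex.Re (u n)).
  move=> eps /cu[M uM]; exists M => m n Mm Mn.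
  by rewrite (le_trans _ (uM _ _ Mm Mn))//= -raddfB normr_Re_le.
have [|b ub] := @real_complete R (fun n => complex.Im (u n)).
  move=> eps /cu[M uM]; exists M => m n Mm Mn.
  by rewrite (le_trans _ (uM _ _ Mm Mn))//= -raddfB normr_Im_le.
exists (Complex a b) => eps e0.
have e20 : 0 < eps / 2 by rewrite divr_gt0.
have [M uM] := ua _ e20; have [M' uM'] := ub _ e20.
exists (maxn M M') => n; rewrite geq_max => /andP[/uM un /uM' u'n].
by rewrite (le_trans (Re_normc_le _))// !raddfB/= (splitr eps) lerD.
Qed.

Lemma Re_normK (R : realType) (a : R[i]) :
  0 <= a -> real_complex R (complex.Re a) = a.
Proof. by case: a => a b; rewrite lecE/= => /andP[/eqP->]. Qed.

Definition realNorms_complex (R : realType) : realNorms R R[i] :=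
  @RealNorms R R[i] (real_complex R) (@complex.Re R) (@lecR R)
    (fun=> erefl) (@Re_normK R) (@complex_complete R).

(** * Coefficients with respect to a Schauder basis *)

Section Coefficients.
Context {K : numFieldType} {V : normedModType K} {e : nat -> V}.
Context (he : schauder_basis e).
Local Notation coef := (coef e).
Local Notation S_ := (S_ e).

Lemma bcoefP x : expansion e x (coef x).
Proof. by apply: xgetPex; have [a []] := he x; exists a. Qed.

(** By uniqueness, every identity between coefficients follows from exhibiting
    one expansion. *)
Lemma bcoef_unique x a : expansion e x a -> coef x = a.
Proof.
by move=> xa; have [b [_ bu]] := he x; rewrite -(bu _ xa) -(bu _ (@bcoefP x)).
Qed.

Lemma bcoef_lin a x y j : coef (a *: x + y) j = a * coef x j + coef y j.
Proof.
suff /bcoef_unique -> : expansion e (a *: x + y)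
  (fun j => a * coef x j + coef y j) by [].
rewrite /expansion; set u := series _.
have -> : u = (fun n => a *: series (fun j => coef x j *: e j) n
                        + series (fun j => coef y j *: e j) n).
  apply/funext => n; rewrite /u /series/= scaler_sumr -big_split/=.
  by apply: eq_bigr => i _; rewrite scalerDl scalerA.
by apply: cvgD; [apply: cvgZr|]; exact: bcoefP.
Qed.

Lemma bcoef0 j : coef 0 j = 0.
Proof.
suff /bcoef_unique -> : expansion e 0 (fun=> 0) by [].
rewrite /expansion (_ : series _ = cst 0); first exact: cvg_cst.
by apply/funext => n; rewrite /series/= big1// => i _; rewrite scale0r.
Qed.

Lemma bcoefD x y j : coef (x + y) j = coef x j + coef y j.
Proof. by have := bcoef_lin 1 x y j; rewrite scale1r mul1r. Qed.

Lemma bcoefZ a x j : coef (a *: x) j = a * coef x j.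
Proof. by have := bcoef_lin a x 0 j; rewrite !addr0 bcoef0 addr0. Qed.

Lemma bcoefB x y j : coef (x - y) j = coef x j - coef y j.
Proof. by rewrite addrC -scaleN1r bcoef_lin mulN1r addrC. Qed.

Lemma bcoef_sum (I : Type) (s : seq I) (F : I -> V) j :
  coef (\sum_(i <- s) F i) j = \sum_(i <- s) coef (F i) j.
Proof.
elim: s => [|i s IH]; first by rewrite !big_nil bcoef0.
by rewrite !big_cons bcoefD IH.
Qed.

Lemma bcoef_basis i j : coef (e i) j = (j == i)%:R.
Proof.
suff /bcoef_unique -> : expansion e (e i) (fun j => (j == i)%:R) by [].
apply: cvg_near_cst; exists i.+1 => // n /= ni.
rewrite /series/= (bigD1_seq i) ?mem_index_iota ?iota_uniq//=.
by rewrite eqxx scale1r big1 ?addr0// => k /negPf->; rewrite scale0r.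
Qed.

Lemma bcoef_comb (A : {fset nat}) (a : nat -> K) j :
  coef (\sum_(i <- A) a i *: e i) j = if j \in A then a j else 0.
Proof.
rewrite bcoef_sum; under eq_bigr do rewrite bcoefZ bcoef_basis.
case: ifPn => jA.
  rewrite (bigD1_seq j) ?fset_uniq//= eqxx mulr1 big1 ?addr0// => i.
  by rewrite eq_sym => /negPf->; rewrite mulr0.
rewrite big_seq big1// => i iA; case: eqP => [ji|]; last by rewrite mulr0.
by rewrite ji iA in jA.
Qed.

Lemma bcoef_S A x j : coef (S_ A x) j = if j \in A then coef x j else 0.
Proof. exact: bcoef_comb. Qed.

Lemma bcoef_inj x y : coef x = coef y -> x = y.
Proof.
move=> xy; have cx := @bcoefP x; rewrite xy in cx.
exact: (cvg_unique _ cx (@bcoefP y)).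
Qed.

Lemma S_B A x y : S_ A (x - y) = S_ A x - S_ A y.
Proof.
apply: bcoef_inj; apply/funext => j; rewrite bcoefB !bcoef_S bcoefB.
by case: ifP; rewrite ?subr0.
Qed.

Lemma S_Z A a x : S_ A (a *: x) = a *: S_ A x.
Proof.
apply: bcoef_inj; apply/funext => j; rewrite bcoefZ !bcoef_S bcoefZ.
by case: ifP; rewrite ?mulr0.
Qed.

Lemma S_id A x : (forall j, j \notin A -> coef x j = 0) -> S_ A x = x.
Proof.
move=> xA; apply: bcoef_inj; apply/funext => j; rewrite bcoef_S.
by case: ifPn => // /xA.
Qed.

(** Asking only that A contain the support leaves room to enlarge A to exactly N
    indices. *)
Lemma SigmaP N y :
  Sigma e N y <-> exists A : {fset nat}, (#|` A| <= N)%N /\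
    (forall j, j \notin A -> coef y j = 0).
Proof.
rewrite /Sigma/=; split=> [yN|[A [AN yA]]].
  have fy := card_le_finite yN (finite_II N).
  exists (fset_set [set j | coef y j != 0]); split.
    by rewrite geq_card_fset_set.
  move=> j; rewrite in_fset_set// => /negP; rewrite inE/= => /negP.
  by rewrite negbK => /eqP.
apply: (@card_le_trans _ _ _ [set` A]).
  by apply: subset_card_le => j /=; apply: contraNT => /yA ->.
have /card_eqPle[h _] : ([set` A] #= `I_(#|` A|))%card by apply/card_eq_fsetP.
by apply: card_le_trans h _; rewrite card_le_II.
Qed.

End Coefficients.

(** Taking [m] large puts the added indices far out, where the coefficients of a
    given vector are small. *)
Lemma fset_extend (A : {fset nat}) m N : (#|` A| <= N)%N ->
  exists B : {fset nat}, [/\ (A `<=` B)%fset, #|` B| = N &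
    forall j, j \in B -> j \notin A -> (m <= j)%N].
Proof.
move=> AN; pose M := maxn m (\max_(i <- A) i).+1.
pose C := [fset x in iota M (N - #|` A|)]%fset.
have CM j : j \in C -> (M <= j)%N by rewrite !inE mem_iota => /andP[].
exists (A `|` C)%fset; split; first exact: fsubsetUl.
  have dis : [disjoint A & C]%fset.
    apply/fdisjointP => j jA; apply/negP => /CM; rewrite geq_max => /andP[_].
    apply/negP; rewrite -leqNgt; exact: (@leq_bigmax_seq _ _ xpredT id j).
  rewrite cardfsU (eqP (dis : (A `&` C == fset0)%fset)) cardfs0 subn0.
  by rewrite card_fseq undup_id ?iota_uniq// size_iota subnKC.
by move=> j; rewrite in_fsetU => /orP[->//|/CM]; rewrite geq_max => /andP[].
Qed.

(** * Baire's theorem *)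

Lemma half_pow_small (R : realType) (c eps : R) : 0 <= c -> 0 < eps ->
  exists M, forall n, (M <= n)%N -> c / 2 ^+ n <= eps.
Proof.
move=> c0 e0; have e0' : 0 < eps / (c + 1) by rewrite divr_gt0// ltr_wpDl.
have [M _ HM] := near_infty_natSinv_expn_lt (PosNum e0').
exists M => n /HM /=; rewrite ltr_pdivlMr ?ltr_wpDl// => /ltW; apply: le_trans.
by rewrite mul1r [leRHS]mulrC ler_wpM2r ?invr_ge0 ?exprn_ge0// lerDl.
Qed.

Section Baire_category.
Context {R : realType} {K : numFieldType} (h : realNorms R K).
Context {V : completeNormedModType K}.
Local Notation nrm := (nrm h).

(** If no set [E k] were dense in a ball, one could choose nested balls, each
    avoiding the next [E k]; the limit of their centers would lie in no
    [E k].  This form of Baire's theorem makes sense over any scalar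
    field. *)
Lemma baire_somewhere_dense (E : nat -> set V) : (forall x, exists k, E k x) ->
  exists k x0, exists2 r : R, 0 < r & forall x, nrm (x - x0) <= r ->
    forall eps : R, 0 < eps -> exists2 y, E k y & nrm (x - y) <= eps.
Proof.
move=> cover; apply: contrapT => nodense.
have H (p : nat * (V * R)) : exists q : V * R, 0 < p.2.2 ->
    [/\ nrm (q.1 - p.2.1) <= p.2.2 / 2, 0 < q.2, q.2 <= p.2.2 / 2 &
        forall y, E p.1 y -> q.2 < nrm (q.1 - y)].
  case: p => k [x0 r] /=; apply: contrapT => noq.
  have r0 : 0 < r.
    by apply: contrapT => /negP r0; apply: noq; exists (x0, r) => /(negP r0).
  apply: nodense; exists k, x0; exists (r / 2); first by rewrite divr_gt0.
  move=> x xr eps e0; apply: contrapT => noy; apply: noq.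
  exists (x, Num.min eps (r / 2)) => _; split => //=.
  - by rewrite lt_min e0 divr_gt0.
  - by rewrite ge_min lexx orbT.
  - move=> y Ey; rewrite gt_min; apply/orP; left; rewrite ltNge.
    by apply/negP => xy; apply: noy; exists y.
have [f fP] := choice H.
(* [s n] is the center and the radius of the [n]-th ball. *)
pose s := fix s n := if n is n'.+1 then f (n', s n') else (0, 1) : V * R.
have s0 n : 0 < (s n).2 by elim: n => [|n IH]//=; have [] := fP (n, s n) IH.
have sP n : [/\ nrm ((s n.+1).1 - (s n).1) <= (s n).2 / 2,
     (s n.+1).2 <= (s n).2 / 2 &
     forall y, E n y -> (s n.+1).2 < nrm ((s n.+1).1 - y)].
  by have [] := fP (n, s n) (s0 n).
have small n : (s n).2 <= 1 / 2 ^+ n.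
  elim: n => [|n IH]; first by rewrite expr0 divr1.
  have [_ + _] := sP n; move/le_trans; apply.
  by rewrite exprS invfM mulrCA mulrC ler_wpM2l.
have nested n k :
    nrm ((s (n + k)%N).1 - (s n).1) + (s (n + k)%N).2 <= (s n).2.
  elim: k => [|k IH]; first by rewrite addn0 subrr nrm0 add0r.
  rewrite addnS; have [A B _] := sP (n + k)%N.
  apply: le_trans IH.
  have := nrm_triangle h (s (n + k)%N).1 (s (n + k).+1).1 (s n).1.
  move: A B; lra.
have near n m : (n <= m)%N -> nrm ((s m).1 - (s n).1) <= (s n).2.
  move=> nm; have := nested n (m - n)%N; rewrite subnKC//.
  by have := s0 m; lra.
have [l sl] : exists l, tends nrm (fun n => (s n).1) l.
  apply: cauchy_tends => eps e0.
  have e20 : 0 < eps / 2 by rewrite divr_gt0.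
  have [M HM] := half_pow_small ler01 e20.
  exists M => m n Mm Mn; rewrite (le_trans (nrm_triangle h (s M).1 _ _))//.
  rewrite (nrmBC _ (s M).1) (splitr eps).
  by rewrite lerD// (le_trans (near _ _ _))// (le_trans (small _))// HM.
have [k Ekl] := cover l; have [_ _ /(_ _ Ekl)] := sP k.
rewrite nrmBC ltNge => /negP; apply; apply: tends_dist_le sl _.
by exists k.+1 => n; exact: near.
Qed.

End Baire_category.

(** * Boundedness of the partial sum operators *)

Section Schauder.
Context {R : realType} {K : numFieldType} (h : realNorms R K).
Context {V : completeNormedModType K} {e : nat -> V}.
Context (he : schauder_basis e) (e1 : normalized e).
Local Notation nrm := (nrm h).
Local Notation coef := (coef e).

Lemma nrm_basis j : nrm (e j) = 1.
Proof. by rewrite /nrm e1 -(rmorph1 (emb h)) embK. Qed.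

Lemma nrmZe a j : nrm (a *: e j) = nrm a.
Proof. by rewrite nrmZ nrm_basis mulr1. Qed.

Definition partial n x : V := series (fun j => coef x j *: e j) n.

Lemma partialS n x : partial n.+1 x = partial n x + coef x n *: e n.
Proof. by rewrite /partial /series/= big_nat_recr. Qed.

Lemma partialB n x y : partial n (x - y) = partial n x - partial n y.
Proof.
rewrite /partial /series/= -sumrB; apply: eq_bigr => j _.
by rewrite (bcoefB he) scalerBl.
Qed.

Lemma partialZ n a x : partial n (a *: x) = a *: partial n x.
Proof.
rewrite /partial /series/= scaler_sumr; apply: eq_bigr => j _.
by rewrite (bcoefZ he) scalerA.
Qed.

Lemma partial0 n : partial n 0 = 0.
Proof. by have := partialB n 0 0; rewrite !subrr. Qed.

Lemma tends_partial x : tends nrm (partial^~ x) x.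
Proof. by apply/tends_cvg; exact: bcoefP. Qed.

Lemma coef_le_partial x j :
  nrm (coef x j) <= nrm (partial j.+1 x) + nrm (partial j x).
Proof.
by rewrite -(nrmZe _ j) -[X in nrm X](addKr (partial j x)) -partialS addrC nrmB.
Qed.

(** The norm sup_n |P_n x|, P_n being the partial sums, is complete: a
    sequence that is Cauchy for it has convergent coefficients, and by
    uniformity in n the limit coefficients expand the limit vector.  Nothing is
    assumed on the continuity of P_n, which is what is being proved; this is
    why the limit is found coefficient by coefficient. *)
Lemma partial_limit (B : nat -> V) (x : V) (eta : nat -> R) :
  tends nrm B x ->
  (forall eps, 0 < eps -> exists M, forall k, (M <= k)%N -> eta k <= eps) ->
  (forall k l n, (k <= l)%N -> nrm (partial n (B k - B l)) <= eta k) ->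
  forall k n, nrm (partial n (x - B k)) <= eta k.
Proof.
move=> Bx eta0 Beta.
have coefB_le j k l : (k <= l)%N ->
    nrm (coef (B k) j - coef (B l) j) <= eta k + eta k.
  move=> kl; rewrite -(bcoefB he) (le_trans (coef_le_partial _ _))//.
  by rewrite lerD ?Beta.
have /choice[a aP] j : exists aj, tends nrm (fun k => coef (B k) j) aj.
  apply: scalars_complete => eps eps0.
  have [|M etaM] := eta0 (eps / 4); first by rewrite divr_gt0.
  exists M => k l Mk Ml; rewrite -/(nrm _).
  have := nrm_triangle h (coef (B M) j) (coef (B k) j) (coef (B l) j).
  have := coefB_le j _ _ Mk; have := coefB_le j _ _ Ml.
  rewrite (nrmBC _ (coef (B k) j) (coef (B M) j)).
  by have := etaM _ (leqnn M); lra.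
have sum_lim n : tends nrm (fun k => partial n (B k))
    (series (fun j => a j *: e j) n).
  elim: n => [|n /tends_cvg IH].
    move=> eps eps0; exists 0%N => k _.
    by rewrite /partial /series/= !big_geq// subrr nrm0 ltW.
  apply/(tends_cvg h); rewrite /series/= big_nat_recr//=.
  under eq_fun do rewrite partialS.
  apply: cvgD => //; apply/(tends_cvg h) => eps /(aP n)[M HM].
  by exists M => k /HM; rewrite -/(nrm _) -scalerBl nrmZe.
have close k n :
    nrm (series (fun j => a j *: e j) n - partial n (B k)) <= eta k.
  apply: tends_dist_le (sum_lim n) _; exists k => l kl.
  by rewrite nrmBC -partialB Beta.
have /(bcoef_unique he) xa : expansion e x a.
  apply/(tends_cvg h) => eps eps0.
  have e30 : 0 < eps / 3 by rewrite divr_gt0.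
  have [M BM] := Bx _ e30; have [M' etaM'] := eta0 _ e30.
  pose k := maxn M M'.
  have [N pN] := @tends_partial (B k) _ e30.
  exists N => n /pN; have := BM k (leq_maxl _ _).
  have := etaM' k (leq_maxr _ _); have := close k n.
  have := nrm_triangle h (B k) x (series (fun j => a j *: e j) n).
  have := nrm_triangle h (partial n (B k)) (B k)
            (series (fun j => a j *: e j) n).
  rewrite (nrmBC _ (partial n (B k)) (series _ _)); lra.
by move=> k n; rewrite partialB {1}/partial xa.
Qed.

Lemma partial_pointwise_bounded x :
  exists k, forall n, nrm (partial n x) <= k%:R.
Proof.
have [M HM] := @tends_partial x 1 ltr01.
pose c := nrm x + 1 + \sum_(0 <= j < M) nrm (coef x j).
exists (Num.truncn c).+1 => n; apply: le_trans (ltW (truncnS_gt c)).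
have sum_ge0 m : 0 <= \sum_(0 <= j < m) nrm (coef x j).
  by apply: sumr_ge0 => j _; exact: nrm_ge0.
have [nM|/ltnW Mn] := leqP n M.
  rewrite /c (big_cat_nat _ nM)//= addrA.
  rewrite -[leLHS]addr0 lerD//.
    rewrite -[leLHS]add0r lerD ?addr_ge0 ?nrm_ge0//.
    rewrite (le_trans (nrm_sum _ _ _))//.
    by apply: ler_sum => j _; rewrite nrmZe.
  by apply: sumr_ge0 => j _; exact: nrm_ge0.
rewrite /c -[leLHS]addr0 lerD// -[partial n x](subrK x) addrC.
rewrite (le_trans (nrmD _ _ _))// addrC [leRHS]addrC lerD// nrmBC.
exact: HM.
Qed.

(** Vectors with all partial sums bounded by some k are dense in a ball around
    some x0.  Differences of two of them are then dense around 0, and a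
    dilation transports this to vectors x of any norm. *)
Lemma bounded_approximation : exists2 c : R, 0 <= c &
  forall x (eps : R), 0 < eps ->
    exists b, nrm (x - b) <= eps /\ forall n, nrm (partial n b) <= c * nrm x.
Proof.
have [k [x0 [r r0 dense]]] :=
  baire_somewhere_dense h partial_pointwise_bounded.
exists (2 * k%:R / r); first by rewrite !mulr_ge0 ?invr_ge0// ltW.
move=> x eps eps0; have [->|x_neq0] := eqVneq x 0.
  by exists 0; split=> [|n]; rewrite ?partial0 ?subrr !nrm0 ?mulr0// ltW.
have t0 : 0 < nrm x by rewrite nrm_gt0.
have s0 : 0 < r / nrm x by rewrite divr_gt0.
set s := r / nrm x in s0.
have e0 : 0 < s * eps / 2 by rewrite divr_gt0// mulr_gt0.
have [|u uk xu] := dense (x0 + emb h s *: x) _ _ e0.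
  by rewrite addrAC subrr add0r nrmZ_emb ?(ltW s0)// /s divfK ?gt_eqF.
have [|v vk xv] := dense x0 _ _ e0; first by rewrite subrr nrm0 ltW.
exists (emb h s^-1 *: (u - v)); split=> [|n].
  have -> : x - emb h s^-1 *: (u - v) =
      emb h s^-1 *: ((x0 + emb h s *: x - u) - (x0 - v)).
    have -> : x0 + emb h s *: x - u - (x0 - v) = emb h s *: x - (u - v).
      rewrite (addrC x0) [X in X - _]addrAC addrKA opprK opprB.
      by rewrite [RHS]addrA [RHS]addrAC.
    by rewrite [RHS]scalerBr scalerA -rmorphM/= mulVf ?gt_eqF// rmorph1 scale1r.
  rewrite nrmZ_emb ?invr_ge0 ?(ltW s0)// ler_pdivrMl//.
  by rewrite (le_trans (nrmB _ _ _))// (splitr (s * eps)) lerD.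
rewrite partialZ partialB nrmZ_emb ?invr_ge0 ?(ltW s0)//.
have -> : 2 * k%:R / r * nrm x = s^-1 * (k%:R + k%:R).
  by rewrite /s invf_div; ring.
by rewrite ler_pM2l ?invr_gt0// (le_trans (nrmB _ _ _))// lerD.
Qed.

(** Each step approximates the error [y k] left by the preceding ones, so well
    that the bound |x| / 2 ^ k on this error is halved.  The partial sums of
    the k-th correction are bounded by c |x| / 2 ^ k, so the approximations
    x - y k of x satisfy the hypotheses of [partial_limit] with the tails of a
    geometric series; at k = 0, where the approximation is 0, its conclusion
    bounds the partial sums of x. *)
Lemma partial_bounded : exists2 c : R, 0 <= c &
  forall x n, nrm (partial n x) <= c * nrm x.
Proof.
have [c c0 cP] := bounded_approximation.
exists (2 * c); first by rewrite mulr_ge0.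
move=> x n; have [->|x_neq0] := eqVneq x 0.
  by rewrite partial0 !nrm0 mulr0.
have t0 : 0 < nrm x by rewrite nrm_gt0.
have H (p : nat * V) : exists b, nrm (p.2 - b) <= nrm x / 2 ^+ p.1.+1 /\
    forall n, nrm (partial n b) <= c * nrm p.2.
  by apply: cP; rewrite divr_gt0// exprn_gt0.
have [f fP] := choice H.
pose y := fix y k := if k is k'.+1 then y k' - f (k', y k') else x.
have y_small k : nrm (y k) <= nrm x / 2 ^+ k.
  case: k => [|k]; first by rewrite expr0 divr1.
  exact: (fP (k, y k)).1.
pose eta k := 2 * c * nrm x / 2 ^+ k.
have halve k : eta k.+1 = eta k / 2.
  by rewrite /eta exprS invfM [2^-1 * _]mulrC mulrA.
(* The k-th correction adds at most [c * nrm x / 2 ^+ k = eta k - eta k.+1]. *)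
have y_partial k i m :
    nrm (partial m (y k - y (k + i)%N)) + eta (k + i)%N <= eta k.
  elim: i => [|i IH]; first by rewrite addn0 subrr partial0 nrm0 add0r.
  apply: le_trans IH; rewrite addnS halve /=.
  rewrite opprB addrCA addrC; set z := f _.
  have -> : partial m (y k - y (k + i)%N + z) =
     partial m (y k - y (k + i)%N) - partial m (- z).
    by rewrite -partialB opprK.
  have := nrmB h (partial m (y k - y (k + i)%N)) (partial m (- z)).
  have : nrm (partial m (- z)) <= eta (k + i)%N / 2.
    rewrite -[- z]add0r partialB partial0 sub0r nrmN.
    rewrite (le_trans ((fP (_, _)).2 m))//= /eta.
    have := ler_wpM2l c0 (y_small (k + i)%N); lra.
  lra.
have eta_ge0 k : 0 <= eta k.
  by rewrite !mulr_ge0 ?invr_ge0 ?exprn_ge0// nrm_ge0.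
have := @partial_limit (fun k => x - y k) x eta _ _ _ 0%N n.
rewrite /= subrr subr0 /eta expr0 divr1; apply.
- move=> eps eps0; have [M HM] := half_pow_small (ltW t0) eps0.
  exists M => k /HM; apply: le_trans; rewrite opprB addrC subrK.
  exact: y_small.
- move=> eps eps0; apply: half_pow_small => //.
  by rewrite !mulr_ge0// nrm_ge0.
- move=> k l m kl.
  have -> : x - y k - (x - y l) = 0 - (y k - y l).
    by rewrite sub0r !opprB addrC addrA subrK.
  rewrite partialB partial0 sub0r nrmN.
  have := y_partial k (l - k)%N m; rewrite subnKC//.
  by have := eta_ge0 l; rewrite /eta; lra.
Qed.

Lemma coef_bounded : exists2 c : R, 0 < c &
  forall x j, nrm (coef x j) <= c * nrm x.
Proof.
have [c c0 cP] := partial_bounded.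
exists (2 * c + 1); first by rewrite ltr_wpDl// mulr_ge0.
move=> x j; rewrite (le_trans (coef_le_partial _ _))//.
have := cP x j; have := cP x j.+1; have := nrm_ge0 h x; nra.
Qed.

End Schauder.

(** * Best approximation and the two inequalities *)

Section Lebesgue_inequality.
Context {R : realType} {K : numFieldType} (h : realNorms R K).
Context {V : completeNormedModType K} {e : nat -> V}.
Context (he : schauder_basis e) (e1 : normalized e).
Context (N : nat).
Local Notation nrm := (nrm h).
Local Notation coef := (coef e).
Local Notation S_ := (S_ e).
Local Notation Sigma := (Sigma e N).
Local Notation sigma := (sigma nrm e N).
Local Notation sigma_exp := (sigma_exp nrm e N).
Local Notation partial := (@partial _ _ e).
Local Notation k_N := (k_ nrm e N).
Local Notation D_N := (D_ nrm e N).

Lemma S_Sigma A x : (#|` A| <= N)%N -> Sigma (S_ A x).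
Proof.
move=> AN; apply/SigmaP; exists A; split=> // j /negPf jA.
by rewrite (bcoef_S he) jA.
Qed.

Lemma sigma_le x y : Sigma y -> sigma x <= nrm (x - y).
Proof.
move=> Sy; apply: ge_inf; last by exists y.
by exists 0 => _ [z _ <-]; exact: nrm_ge0.
Qed.

Lemma le_sigma x c : (forall y, Sigma y -> c <= nrm (x - y)) -> c <= sigma x.
Proof.
move=> cP; apply: lb_le_inf => [|_ [y Sy <-]]; last exact: cP.
exists (nrm (x - S_ fset0 x)), (S_ fset0 x) => //.
by apply: S_Sigma; rewrite cardfs0.
Qed.

Lemma sigma_ge0 x : 0 <= sigma x.
Proof. by apply: le_sigma => y _; exact: nrm_ge0. Qed.

Lemma sigma_exp_le A x : #|` A| = N -> sigma_exp x <= nrm (x - S_ A x).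
Proof.
move=> AN; apply: ge_inf; last by exists A.
by exists 0 => _ [B _ <-]; exact: nrm_ge0.
Qed.

Lemma le_sigma_exp x c :
  (forall A : {fset nat}, #|` A| = N -> c <= nrm (x - S_ A x)) ->
  c <= sigma_exp x.
Proof.
move=> cP; apply: lb_le_inf => [|_ [A AN <-]]; last exact: cP.
have [|A [_ AN _]] := @fset_extend fset0 0 N; first by rewrite cardfs0.
by exists (nrm (x - S_ A x)), A.
Qed.

Lemma sigma_le_sigma_exp x : sigma x <= sigma_exp x.
Proof.
apply: le_sigma_exp => A AN; apply: sigma_le.
by apply: S_Sigma; rewrite AN.
Qed.

Lemma not_Sigma x : ~ Sigma x ->
  exists2 A : {fset nat}, (N < #|` A|)%N & forall j, j \in A -> coef x j != 0.
Proof.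
move=> xN; have [fx|ix] := pselect (finite_set [set j | coef x j != 0]).
  exists (fset_set [set j | coef x j != 0]); last first.
    by move=> j; rewrite in_fset_set// inE.
  rewrite ltnNge; apply/negP => leN; apply: xN; apply/SigmaP.
  exists (fset_set [set j | coef x j != 0]); split=> // j.
  by rewrite in_fset_set// notin_setE/= => /negP; rewrite negbK => /eqP.
have [A Ax AN] := infinite_set_fset N.+1 ix.
by exists A => // j /Ax.
Qed.

(** A vector with more than N nonzero coefficients shares one of them with its
    difference to any N-term vector, and the coefficient functionals are
    bounded. *)
Lemma sigma_gt0 x : ~ Sigma x -> 0 < sigma x.
Proof.
move=> /not_Sigma[A AN xA]; have [c c0 cP] := coef_bounded h he e1.
have [m m0 mP] : exists2 m : R, 0 < m &
    forall j, j \in A -> m <= nrm (coef x j).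
  have : forall j, j \in enum_fset A -> coef x j != 0 by [].
  suff : forall s : seq nat, (forall j, j \in s -> coef x j != 0) ->
    exists2 m : R, 0 < m & forall j, j \in s -> m <= nrm (coef x j) by apply.
  elim=> [|i s IH] xs; first by exists 1 => //; exact: ltr01.
  have [j js|m m0 mP] := IH; first by apply: xs; rewrite in_cons js orbT.
  exists (Num.min m (nrm (coef x i))) => [|j].
    by rewrite lt_min m0 nrm_gt0 xs// mem_head.
  rewrite in_cons => /orP[/eqP->|/mP mj]; first by rewrite ge_min lexx orbT.
  by rewrite ge_min mj.
apply: (@lt_le_trans _ _ (m / c)); first by rewrite divr_gt0.
apply: le_sigma => y /SigmaP[B [BN yB]].
have /fsubsetPn[j jA jB] : ~~ (A `<=` B)%fset.
  by apply: contraL AN => /fsubset_leq_card AB; rewrite -leqNgt (leq_trans AB).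
rewrite ler_pdivrMr// mulrC (le_trans (mP j jA))//.
by rewrite (le_trans _ (cP _ j))// (bcoefB he) yB// subr0.
Qed.

Lemma opnorm_le A x (k : R) : (opnorm nrm (S_ A) <= k%:E)%E ->
  nrm (S_ A x) <= k * nrm x.
Proof.
move=> Ak; have [->|x_neq0] := eqVneq x 0.
  by rewrite -[X in S_ _ X](scale0r (0 : V)) (S_Z he) scale0r !nrm0 mulr0 lexx.
have t0 : 0 < nrm x by rewrite nrm_gt0.
have : ((nrm (S_ A (emb h (nrm x)^-1 *: x)))%:E <= k%:E)%E.
  apply: le_trans Ak; apply: ereal_sup_ubound.
  exists (emb h (nrm x)^-1 *: x) => //=.
  by rewrite nrmZ_emb ?invr_ge0 ?nrm_ge0// mulVf// gt_eqF.
rewrite lee_fin (S_Z he) nrmZ_emb ?invr_ge0 ?nrm_ge0//.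
by rewrite ler_pdivrMl// mulrC.
Qed.

Lemma k_ge1 : (0 < N)%N -> (1 <= k_N)%E.
Proof.
move=> N0; apply: (@le_trans _ _ (opnorm nrm (S_ [fset 0%N]%fset))).
  apply: ereal_sup_ge; exists (nrm (S_ [fset 0%N]%fset (e 0%N)))%:E.
    by exists (e 0%N) => //=; rewrite nrm_basis.
  by rewrite /Defs.S_ big_seq_fset1 (bcoef_basis he) eqxx scale1r nrm_basis.
apply: ereal_sup_ubound; exists [fset 0%N]%fset => //=.
by rewrite cardfs1.
Qed.

Lemma D_le_2k : (0 < N)%N -> (D_N <= 2%:E * k_N)%E.
Proof.
move=> N0; have := k_ge1 N0; case kE : k_N => [k| |]//; last first.
  by move=> _; rewrite gt0_muley ?leey ?lte_fin ?ltr0n.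
rewrite lee_fin => k1; apply: ge_ereal_sup => _ [x /= x0 <-].
have xgt0 : 0 < sigma x by rewrite lt_neqAle eq_sym x0 sigma_ge0.
have k0 : 0 < 2 * k by lra.
rewrite -EFinM lee_fin ler_pdivrMr// -ler_pdivrMl//.
apply: le_sigma => y /SigmaP[B [BN yB]].
rewrite ler_pdivrMl//.
have [A [BA AN _]] := fset_extend 0 BN.
have SAy : S_ A y = y.
  by apply: S_id => // j jA; apply: yB; apply: contra jA; exact/fsubsetP.
apply: le_trans (sigma_exp_le x AN) _.
have -> : x - S_ A x = (x - y) - S_ A (x - y).
  by rewrite (S_B he) SAy opprB addrA subrK.
rewrite (le_trans (nrmB _ _ _))//.
have : nrm (S_ A (x - y)) <= k * nrm (x - y).
  apply: opnorm_le; rewrite -kE; apply: ereal_sup_ubound.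
  by exists A => //=; rewrite AN.
have := nrm_ge0 h (x - y); nra.
Qed.

(** The inequality sigma_N <= tilde sigma_N is not enough: there must be a
    vector with sigma_N nonzero, here the sum of N + 1 basis vectors. *)
Lemma D_ge1 : (1 <= D_N)%E.
Proof.
have [|A [_ AN _]] := @fset_extend fset0 0 N.+1; first by rewrite cardfs0.
pose w := \sum_(j <- A) 1 *: e j.
have w0 : 0 < sigma w.
  apply: sigma_gt0 => /SigmaP[B [BN wB]].
  suff /fsubset_leq_card : (A `<=` B)%fset by rewrite AN ltnNge BN.
  apply/fsubsetP => j jA; apply: contraT => /wB.
  by rewrite (bcoef_comb he A (fun=> 1)) jA => /eqP; rewrite oner_eq0.
apply: ereal_sup_ge; exists (sigma_exp w / sigma w)%:E.
  by exists w => //=; rewrite gt_eqF.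
by rewrite lee_fin ler_pdivlMr// mul1r sigma_le_sigma_exp.
Qed.

Lemma sigma_exp_le_D x (d : R) : D_N = d%:E -> sigma x != 0 ->
  sigma_exp x <= d * sigma x.
Proof.
move=> dE x0; rewrite -ler_pdivrMr; last first.
  by rewrite lt_neqAle eq_sym x0 sigma_ge0.
by rewrite -lee_fin -dE; apply: ereal_sup_ubound; exists x.
Qed.

(** The ratio that defines D_N is tested on the vector z obtained from x by
    giving one large coefficient to all the indices of A. *)
Lemma residual_le_D (A : {fset nat}) x (d : R) : D_N = d%:E -> #|` A| = N ->
  nrm (x - S_ A x) <= d * nrm x.
Proof.
move=> dE AN; have d1 : 1 <= d by rewrite -lee_fin -dE D_ge1.
have [c c0 cP] := coef_bounded h he e1.
(* So large that a residual with coefficient [t] is larger in norm than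
   [x - S_ A x]. *)
pose t := c * nrm (x - S_ A x) + 1.
have t0 : 0 < t by rewrite ltr_wpDl// mulr_ge0 ?nrm_ge0// ltW.
pose y := \sum_(j <- A) (emb h t - coef x j) *: e j.
pose z := x + y.
have zA j : coef z j = if j \in A then emb h t else coef x j.
  rewrite (bcoefD he) (bcoef_comb he A (fun j => emb h t - coef x j)).
  by case: ifP => _; rewrite ?addr0// addrC subrK.
have zSA : z - S_ A z = x - S_ A x.
  apply: (bcoef_inj he); apply/funext => j.
  rewrite !(bcoefB he) !(bcoef_S he) zA.
  by case: ifP => _; rewrite ?subrr ?subr0.
(* If z is itself an N-term vector, then its support is A and x = S_A x. *)
have [zS|zS] := pselect (Sigma z).
  suff -> : x - S_ A x = 0 by rewrite nrm0 mulr_ge0 ?nrm_ge0// (le_trans ler01).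
  rewrite -zSA S_id ?subrr// => j jA; apply/eqP.
  move: zS => /SigmaP[B [BN zB]]; apply: contraTT BN => zj.
  rewrite -ltnNge -AN -[#|` A|.+1]add1n.
  have <- : #|` (j |` A)%fset| = (1 + #|` A|)%N by rewrite cardfsU1 jA.
  apply: fsubset_leq_card; apply/fsubsetP => i; rewrite in_fset1U.
  case/orP => [/eqP->|iA]; apply: contraT => /zB zi.
    by rewrite zi eqxx in zj.
  by move: zi; rewrite zA iA => /eqP; rewrite -(rmorph0 (emb h))
    (inj_eq (can_inj (embK h))) gt_eqF.
apply: (@le_trans _ _ (sigma_exp z)).
  apply: le_sigma_exp => B BN; have [<-|AB] := pselect (A = B).
    by rewrite -zSA.
  have /fsubsetPn[j jA jB] : ~~ (A `<=` B)%fset.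
    apply/negP => sAB; apply: AB.
    by apply/eqP; rewrite eqEfcard sAB AN BN leqnn.
  rewrite -(ler_pM2l c0) (le_trans _ (cP _ j))// (bcoefB he) (bcoef_S he).
  rewrite (negPf jB) subr0 zA jA nrm_emb ?(ltW t0)//.
  by rewrite /t lerDl.
apply: le_trans (sigma_exp_le_D dE _) _; first by rewrite gt_eqF// sigma_gt0.
rewrite ler_wpM2l ?(le_trans ler01)//.
have -> : nrm x = nrm (z - y) by rewrite addrK.
apply: sigma_le; apply/SigmaP; exists A; split; first by rewrite AN.
move=> j /negPf jA.
by rewrite (bcoef_comb he A (fun j => emb h t - coef x j)) jA.
Qed.

Lemma coef_small x (eps : R) : 0 < eps ->
  exists M, forall j, (M <= j)%N -> nrm (coef x j) <= eps.
Proof.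
move=> eps0; have e20 : 0 < eps / 2 by rewrite divr_gt0.
have [M HM] := tends_partial h he x e20.
exists M => j Mj; rewrite -(nrmZe h e1 _ j) -[X in nrm X](addKr (partial j x)).
rewrite -partialS addrC (le_trans (nrm_triangle h x _ _))// (splitr eps).
by rewrite (nrmBC _ _ x) lerD ?HM// leqW.
Qed.

Lemma S_small (A : {fset nat}) x (eps : R) :
  (forall j, j \in A -> nrm (coef x j) <= eps) ->
  nrm (S_ A x) <= eps *+ #|` A|.
Proof.
move=> Aeps; rewrite (le_trans (nrm_sum _ _ _))//.
rewrite -iter_addr_0 -[X in iter X]count_predT -big_const_seq.
by rewrite big_seq [leRHS]big_seq; apply: ler_sum => j jA; rewrite nrmZe ?Aeps.
Qed.

Lemma quarter_k_le_D : (0 < N)%N -> ((4^-1)%:E * k_N <= D_N)%E.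
Proof.
move=> N0; have := D_ge1; case dE : D_N => [d| |]//; last first.
  by move=> _; rewrite leey.
rewrite lee_fin => d1; rewrite lee_pdivrMl//.
apply: ge_ereal_sup => _ [A /= AN <-]; apply: ge_ereal_sup => _ [x /= x1 <-].
rewrite -EFinM lee_fin.
have [|M xM] := @coef_small x (N%:R^-1); first by rewrite invr_gt0 ltr0n.
have [B [AB BN BM]] := fset_extend M AN.
have -> : S_ A x = x - (x - S_ B x) - S_ (B `\` A)%fset x.
  apply: (bcoef_inj he); apply/funext => j.
  rewrite !(bcoefB he) !(bcoef_S he) in_fsetD subKr.
  have [/(fsubsetP AB)->|_] := boolP (j \in A); first by rewrite subr0.
  by rewrite subrr.
have small : nrm (S_ (B `\` A)%fset x) <= 1.
  apply: le_trans (S_small (eps := N%:R^-1) _) _.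
    by move=> j; rewrite in_fsetD => /andP[jA jB]; rewrite xM// BM.
  rewrite -[_^-1 *+ _]mulr_natl ler_pdivrMr ?ltr0n// mul1r ler_nat -BN.
  by rewrite fsubset_leq_card// fsubsetDl.
have := residual_le_D x dE BN.
have := nrmB h (x - (x - S_ B x)) (S_ (B `\` A)%fset x).
have := nrmB h x (x - S_ B x).
have := ler_wpM2l (le_trans ler01 d1) x1.
lra.
Qed.

End Lebesgue_inequality.

Theorem theorem1p2 (R : realType) :
  (forall (X : completeNormedModType R) (e : nat -> X),
     schauder_basis e -> normalized e ->
     forall N : nat, (1 <= N)%N ->
       ((4^-1)%:E * k_ real_norm e N <= D_ real_norm e N)%E /\
       (D_ real_norm e N <= 2%:E * k_ real_norm e N)%E) /\
  (forall (X : completeNormedModType R[i]) (e : nat -> X),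
     schauder_basis e -> normalized e ->
     forall N : nat, (1 <= N)%N ->
       ((4^-1)%:E * k_ complex_norm e N <= D_ complex_norm e N)%E /\
       (D_ complex_norm e N <= 2%:E * k_ complex_norm e N)%E).
Proof.
split=> X e he e1 N N0; split.
- exact: (quarter_k_le_D (realNorms_real R) he e1 N0).
- exact: (D_le_2k (realNorms_real R) he e1 N0).
- exact: (quarter_k_le_D (realNorms_complex R) he e1 N0).
- exact: (D_le_2k (realNorms_complex R) he e1 N0).
Qed.
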